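(* Let $k$ be a field and $n\ge5$. Every effective divisor class $D$ on $\overline{\mathcal M}_{0,n}$ with $\deg^{\min}(D)\in\{0,1\}$ is a nonnegative integer combination of classes of boundary divisors.
   Context: For each $i\in[n]$ there is a Kapranov isomorphism $\overline{\mathcal M}_{0,n}\cong\operatorname{Bl}\mathbb P^{n-3}$ associated with the psi-class $\psi_i$ (equivalently: fix $n-1$ general lines in $\mathbb P^2$ indexed by $[n]\setminus\{i\}$ and a point $p$ on none of them; the pencil of lines through $p$, with $p$ as $i$-th marked point and the intersections with the lines as the others, gives a curve $C_i\subset\overline{\mathcal M}_{0,n}$). The degree $\deg^i(D)$ is the coefficient of the hyperplane class $H$ in $D$ under the $i$-th isomorphism, equivalently $D\cdot C_i$; $\deg^{\min}(D)=\min_{1\le i\le n}\deg^i(D)$. Boundary divisors of $\overline{\mathcal M}_{0,n}$ are the divisors of nodal curves; in a Kapranov model they are the exceptional divisors $E_I$ and the strict transforms of hyperplanes spanned by $n-3$ of the blown-up points. *)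

(* Defs.v *)
From HB Require Import structures.
From mathcomp Require Import all_boot all_order all_algebra.
Set Implicit Arguments. Unset Strict Implicit. Unset Printing Implicit Defensive.
Import Order.TTheory GRing.Theory Num.Theory.
Local Open Scope ring_scope.

(* Conventions.  Marked points of M_{0,n}-bar are indexed by 'I_n; the last   *)
(* one (value n-1) is the distinguished point for the fixed Kapranov model    *)
(* M_{0,n}-bar = Bl P^{n-3}, in which the other n-1 marked points (values     *)
(* 0..n-2, type 'I_n.-1) are the blown-up points p_0..p_{n-2} of P^{n-3}:     *)
(*   p_a = e_a (a < n-2),   p_{n-2} = (1,...,1)   (homogeneous coordinates    *)
(* indexed by 'I_n.-2).  For I a set of blown-up points with                  *)
(* 1 <= |I| <= n-4, E_I is the exceptional divisor over the span L_I.         *)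
(* Pic = Z H (+) (+)_I Z E_I; a class  d H - sum_I m_I E_I  is stored as the  *)
(* pair (d, m) (values of m outside the valid I's are irrelevant).           *)

Definition validE (n : nat) (I : {set 'I_n.-1}) : bool :=
  (1 <= #|I|)%N && (#|I| <= n - 4)%N.

(* sets J of n-3 blown-up points: their span is a hyperplane *)
Definition validH (n : nat) (J : {set 'I_n.-1}) : bool := #|J| == (n - 3)%N.

Definition kclass (n : nat) := (int * ({set 'I_n.-1} -> int))%type.

Definition kc_eq (n : nat) (D D' : kclass n) : Prop :=
  D.1 = D'.1 /\ forall I, validE I -> D.2 I = D'.2 I.

(* Boundary divisor classes: exceptional divisors E_I (= D_{I u {n}}) and    *)
(* strict transforms of the hyperplanes spanned by n-3 blown-up points J,    *)
(* of class  H - sum_{I subset J} E_I  (= D_{complement of J in [n-1]}).     *)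
Definition bE (n : nat) (I : {set 'I_n.-1}) : kclass n :=
  (0, fun K : {set 'I_n.-1} => if K == I then -1 else 0).
Definition bH (n : nat) (J : {set 'I_n.-1}) : kclass n :=
  (1, fun K : {set 'I_n.-1} => if K \subset J then 1 else 0).

Definition boundary_comb (n : nat) (D : kclass n) : Prop :=
  exists cE cH : {set 'I_n.-1} -> nat,
    kc_eq D
      (\sum_(I | validE I) (cE I)%:Z * (bE I).1
         + \sum_(J | validH J) (cH J)%:Z * (bH J).1,
       fun K => \sum_(I | validE I) (cE I)%:Z * (bE I).2 K
         + \sum_(J | validH J) (cH J)%:Z * (bH J).2 K).

(* deg^j(D) = D . C_j.  For the distinguished point this is d; for a        *)
(* blown-up point a it is (n-3) d - sum_{b <> a} m_{b}, since C_a . H = n-3, *)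
(* C_a . E_{b} = 1 for b <> a and C_a . E_I = 0 otherwise.                   *)
Definition deg_at (n : nat) (D : kclass n) (j : 'I_n) : int :=
  if (j : nat) == n.-1 then D.1
  else (n - 3)%N%:Z * D.1
       - \sum_(b : 'I_n.-1 | (b : nat) != (j : nat)) D.2 [set b].

(* the minimum over all j in [n]; the seed D.1 equals deg^{n}, so it does   *)
(* not change the minimum (n >= 1).                                          *)
Definition deg_min (n : nat) (D : kclass n) : int :=
  \big[Num.min/D.1]_(j < n) deg_at D j.

(* homogeneous polynomials of degree d in the n-2 coordinates of P^{n-3}   *)
Definition mono (n d : nat) := {ffun 'I_n.-2 -> 'I_d.+1}.
Definition is_mono (n d : nat) (a : mono n d) : bool :=
  (\sum_(i < n.-2) (a i : nat))%N == d.
Definition hpoly (k : fieldType) (n d : nat) := {ffun mono n d -> k}.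
Definition hp_nonzero (k : fieldType) (n d : nat) (F : hpoly k n d) : bool :=
  [exists a : mono n d, is_mono a && (F a != 0)].

Definition kap_pt (K : fieldType) (n : nat) (a : 'I_n.-1) (i : 'I_n.-2) : K :=
  if (a : nat) == n.-2 then 1 else if (a : nat) == (i : nat) then 1 else 0.

Definition line_restr (k K : fieldType) (f : {rmorphism k -> K}) (n d : nat)
  (F : hpoly k n d) (u w : 'I_n.-2 -> K) : {poly K} :=
  \sum_(a : mono n d | is_mono a)
     f (F a) *: \prod_(i < n.-2) ((u i)%:P + (w i)%:P * 'X) ^+ (a i : nat).

(* F vanishes to order >= m along the linear span L_I: for every field      *)
(* extension K, every point u of L_I(K) and direction w, the restriction     *)
(* t |-> F(u + t w) vanishes to order >= m at t = 0.                         *)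
Definition mult_ge (k : fieldType) (n d : nat) (F : hpoly k n d)
  (I : {set 'I_n.-1}) (m : int) : Prop :=
  forall (K : fieldType) (f : {rmorphism k -> K}) (s : 'I_n.-1 -> K)
         (w : 'I_n.-2 -> K) (j : nat),
    j%:Z < m ->
    (line_restr f F (fun i => \sum_(a in I) s a * kap_pt K a i) w)`_j = 0.

(* d H - sum m_I E_I is effective iff some nonzero degree-d form F over k   *)
(* has multiplicity >= m_I along each L_I (then the divisor                 *)
(* strict transform of {F=0} + sum_I (mult_{L_I} F - m_I) E_I  lies in it).  *)
Definition effective (k : fieldType) (n : nat) (D : kclass n) : Prop :=
  exists (d : nat) (F : hpoly k n d),
    D.1 = d%:Z /\ hp_nonzero F /\ forall I, validE I -> mult_ge F I (D.2 I).

(* Main.v *)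
Require Import Defs.
From HB Require Import structures.
From mathcomp Require Import all_boot all_order all_algebra all_fingroup.
From mathcomp Require Import mpoly.
From mathcomp Require Import zify ring.
Import Order.TTheory GRing.Theory Num.Theory.
Local Open Scope ring_scope.
Set Implicit Arguments. Unset Strict Implicit. Unset Printing Implicit Defensive.

(* Let F be a form defining D, and let a be a marked point with deg^a(D) <= 1.
   It suffices to find d hyperplanes spanned by blown-up points such that each
   L_I lies in at least m_I of them: then D is their sum plus a nonnegative
   combination of the E_I.  A projective change of coordinates permuting the
   blown-up points lets one assume that a is the distinguished point or the
   point (1, ..., 1).  For a coordinate subspace L_I and any monomial x^g of F,
   m_I is at most the degree of x^g in the variables vanishing on L_I, so the
   hyperplanes x_i = 0, each taken g_i times, suffice whenever
   F(1, ..., 1) <> 0.  Otherwise F has two monomials; deg^a(D) <= 1 then bounds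
   the exponents so tightly (F is a linear form, or a monomial times the Cremona
   transform of one) that two of them are x^g x_i and x^g x_j, and the
   hyperplane x_i = x_j together with those of x^g suffices. *)

(** * Evaluation of multivariate polynomials *)

Lemma rmorph_mmap (r : nat) (k R S : comNzRingType) (phi : {rmorphism R -> S})
  (f : k -> R) (h : 'I_r -> R) (p : {mpoly k[r]}) :
  phi (mmap f h p) = mmap (phi \o f) (phi \o h) p.
Proof.
rewrite /mmap rmorph_sum; apply: eq_bigr => a _.
rewrite rmorphM rmorph_prod; congr (_ * _).
by apply: eq_bigr => i _; rewrite rmorphXn.
Qed.

Lemma eq_mmap (r : nat) (k R : nzRingType) (f g : k -> R) (h l : 'I_r -> R)
  (p : {mpoly k[r]}) : f =1 g -> h =1 l -> mmap f h p = mmap g l p.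
Proof.
move=> fg hl; rewrite /mmap; apply: eq_bigr => a _.
by rewrite fg (mmap1_eq _ hl).
Qed.

Lemma mmap_single (r : nat) (k R : comNzRingType) (f : k -> R) (z : R)
  (i : 'I_r) (p : {mpoly k[r]}) :
  mmap f (fun j => if j == i then z else 1) p
  = \sum_(a <- msupp p) f p@_a * z ^+ a i.
Proof.
rewrite /mmap; apply: eq_bigr => a _; congr (_ * _).
rewrite /mmap1 (bigD1 i) //= eqxx big1 ?mulr1 // => j /negbTE ->.
by rewrite expr1n.
Qed.

Lemma coef1_exp_1DX (R : comNzRingType) e : ((1 + 'X : {poly R}) ^+ e)`_1 = e%:R.
Proof.
suff [] : ((1 + 'X : {poly R}) ^+ e)`_0 = 1 /\ ((1 + 'X : {poly R}) ^+ e)`_1 = e%:R by [].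
elim: e => [|e [IH0 IH1]]; first by rewrite expr0 !coef1.
rewrite exprS mulrDl mul1r !coefD !coefXM /= IH0 IH1 addr0; split=> //.
by rewrite -natr1.
Qed.

(** * Vanishing orders along spans of blown-up points, with n = m + 3 *)

Section Multiplicity.
Variables (k : fieldType) (m : nat).
Implicit Types (p : {mpoly k[m.+1]}) (I : {set 'I_m.+2}).

(** Index of the blown-up point e_i; the remaining index [ord_max] is that of (1, ..., 1). *)
Definition coord_pt (i : 'I_m.+1) : 'I_m.+2 := lift ord_max i.

Lemma coord_pt_inj : injective coord_pt.
Proof. exact: lift_inj. Qed.

Lemma coord_pt_neq_max i : (coord_pt i == ord_max) = false.
Proof. by rewrite eq_sym; apply/negbTE/neq_lift. Qed.

Lemma big_points (V : nmodType) (F : 'I_m.+2 -> V) :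
  \sum_b F b = F ord_max + \sum_i F (coord_pt i).
Proof. by rewrite (bigD1_ord ord_max). Qed.

Definition span_pt (K : fieldType) I (s : 'I_m.+2 -> K) : 'I_m.+1 -> K :=
  fun i => \sum_(a in I) s a * @kap_pt K m.+3 a i.

Definition line_mpoly (K : fieldType) (f : {rmorphism k -> K}) p
  (u w : 'I_m.+1 -> K) : {poly K} :=
  mmap (polyC \o f) (fun i => (u i)%:P + (w i)%:P * 'X) p.

Definition vanishes p I (c : int) : Prop :=
  forall (K : fieldType) (f : {rmorphism k -> K}) (s : 'I_m.+2 -> K)
         (w : 'I_m.+1 -> K) (j : nat),
    j%:Z < c -> (line_mpoly f p (span_pt I s) w)`_j = 0.

Lemma kap_pt_max (K : fieldType) i : @kap_pt K m.+3 (ord_max : 'I_m.+2) i = 1.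
Proof. by rewrite /kap_pt /= eqxx. Qed.

Lemma kap_pt_coord (K : fieldType) i j :
  @kap_pt K m.+3 (coord_pt i) j = (i == j)%:R.
Proof.
rewrite /kap_pt /coord_pt lift_max /= ltn_eqF //.
by rewrite -val_eqE /=; case: ifP.
Qed.

Lemma span_ptE (K : fieldType) I (s : 'I_m.+2 -> K) i :
  span_pt I s i = (if ord_max \in I then s ord_max else 0)
                  + (if coord_pt i \in I then s (coord_pt i) else 0).
Proof.
rewrite /span_pt big_mkcond big_points kap_pt_max mulr1; congr (_ + _).
rewrite (bigD1 i) //= kap_pt_coord eqxx mulr1 big1 ?addr0 // => j /negbTE ji.
by rewrite kap_pt_coord ji mulr0 if_same.
Qed.

Lemma vanishes_eval p I (c : int) (K : fieldType) (f : {rmorphism k -> K}) s :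
  vanishes p I c -> 0 < c -> mmap f (span_pt I s) p = 0.
Proof.
move=> pI c0; rewrite -(pI K f s (fun=> 0) 0%N c0) -horner_coef0 /line_mpoly.
rewrite -[RHS]/(horner_eval 0 _) rmorph_mmap.
apply: eq_mmap => x /=; first by rewrite /horner_eval hornerC.
by rewrite /horner_eval mul0r addr0 hornerC.
Qed.

(** The base point takes the coordinates of [y] in [A] and the direction takes the others, so x^b
    restricts to y^b times 'X to the degree of b outside [A]. *)
Lemma line_coord_split p I (K : fieldType) (f : {rmorphism k -> K})
  (A : {set 'I_m.+1}) (y : 'I_m.+1 -> K) :
  coord_pt @: A \subset I ->
  exists s w, line_mpoly f p (span_pt I s) w
    = \sum_(b <- msupp p) (f p@_b * mmap1 y b)%:P * 'X ^+ (\sum_(i in ~: A) b i).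
Proof.
move=> AI.
pose s (b : 'I_m.+2) :=
  if unlift ord_max b is Some i then if i \in A then y i else 0 else 0.
pose w i := if i \in A then 0 else y i.
exists s, w.
have hE i : (span_pt I s i)%:P + (w i)%:P * 'X
            = (y i)%:P * 'X ^+ (i \in ~: A).
  rewrite span_ptE /s /coord_pt unlift_none liftK /w inE if_same add0r.
  have [iA|iA] := boolP (i \in A); last by rewrite if_same add0r expr1.
  by rewrite (subsetP AI) ?imset_f // mul0r addr0 expr0 mulr1.
rewrite /line_mpoly (eq_mmap _ (fun=> erefl) hE) /mmap; apply: eq_bigr => b _.
rewrite polyCM -mulrA; congr (_ * _).
rewrite /mmap1 rmorph_prod expr_sum [X in _ * X]big_mkcond -big_split /=.
apply: eq_bigr => i _; rewrite exprMn -exprM rmorphXn /=; congr (_ * _).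
by case: (i \in ~: A); rewrite ?mul1n // mul0n expr0.
Qed.

(* Restricting to a line through two complementary pieces of the generic
   point separates all monomials of [p]. *)
Lemma vanishes_le p I (c : int) (A : {set 'I_m.+1}) (a : 'X_{1..m.+1}) :
  vanishes p I c -> coord_pt @: A \subset I -> a \in msupp p ->
  c <= (\sum_(i in ~: A) a i)%N%:Z.
Proof.
move=> pI AI ap; rewrite leNgt; apply/negP => ac.
pose wt (b : 'X_{1..m.+1}) := (\sum_(i in ~: A) b i)%N.
(* Over the function field the coordinates [y] are the variables themselves, so distinct monomials
   stay linearly independent. *)
pose f : {rmorphism k -> {fraction {mpoly k[m.+1]}}} :=
  @tofrac {mpoly k[m.+1]} \o @mpolyC m.+1 k.
pose y (i : 'I_m.+1) : {fraction {mpoly k[m.+1]}} := tofrac 'X_i.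
have [s [w lineE]] := line_coord_split p f y AI.
have /eqP := pI _ f s w _ ac.
(* The terms of [p] with the same degree outside [A] as [a]; the term of [a] itself keeps [q]
   nonzero. *)
pose q : {mpoly k[m.+1]} :=
  \sum_(b <- msupp p) (p@_b * (wt a == wt b)%:R) *: 'X_[b].
have -> : (line_mpoly f p (span_pt I s) w)`_(\sum_(i in ~: A) a i) = tofrac q.
  rewrite lineE coef_sum rmorph_sum; apply: eq_bigr => b _.
  rewrite coefCM coefXn -mul_mpolyC rmorphM /= mpolyCM rmorphM /= -!mulrA.
  congr (_ * _); rewrite mulrC; congr (_ * _).
    by case: (_ == _); rewrite ?mpolyC1 ?mpolyC0 ?rmorph1 ?rmorph0.
  rewrite -[in RHS]mmap1_id /mmap1 rmorph_prod.
  by apply: eq_bigr => i _; rewrite rmorphXn.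
rewrite tofrac_eq0 => /eqP/(congr1 (mcoeff a)).
rewrite mcoeff0 /q raddf_sum /= (bigD1_seq a) ?msupp_uniq //= big1 => [|b /negbTE ba].
  by rewrite mcoeffZ mcoeffX !eqxx !mulr1 addr0 => /eqP; rewrite mcoeff_eq0 ap.
by rewrite mcoeffZ mcoeffX ba mulr0.
Qed.

Definition value_at_ones p : k := \sum_(a <- msupp p) p@_a.

Lemma mmap_ones (K : comNzRingType) (f : {rmorphism k -> K}) p :
  mmap f (fun=> 1) p = f (value_at_ones p).
Proof.
rewrite /mmap rmorph_sum; apply: eq_bigr => a _.
by rewrite /mmap1 big1 ?mulr1 // => i _; rewrite expr1n.
Qed.

(** The point (1, ..., 1) lies on L_I, so positive multiplicity would make [p] vanish there. *)
Lemma vanishes_max_le0 p I (c : int) :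
  vanishes p I c -> ord_max \in I -> value_at_ones p != 0 -> c <= 0.
Proof.
move=> pI Imax; apply: contraR; rewrite -ltNge => c0.
pose s (b : 'I_m.+2) : k := (b == ord_max)%:R.
rewrite -[value_at_ones p]/(idfun _) -mmap_ones.
rewrite -(vanishes_eval idfun s pI c0); apply/eqP/eq_mmap => // i.
by rewrite span_ptE Imax /s eqxx coord_pt_neq_max if_same addr0.
Qed.

(* Along the line from the point (1, ..., 1) towards the [i]-th coordinate
   point, [p] has derivative [- p@_a] at (1, ..., 1). *)
Lemma vanishes_max_deriv p I (c : int) (a : 'X_{1..m.+1}) i e :
  vanishes p I c -> ord_max \in I -> value_at_ones p = 0 ->
  a \in msupp p -> (forall b, b \in msupp p -> (b i + (b == a))%N = e) ->
  c <= 1 /\ (coord_pt i \in I -> c <= 0).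
Proof.
move=> pI Imax p1 ap supp_e.
(* Put z = 1 + 'X for x_i and 1 for the other variables. As [a] has exponent e - 1 at [i], all other
   monomials have e, and the coefficients sum to 0, this is p@_a (z^(e-1) - z^e), whose linear term
   is nonzero in every characteristic. *)
pose q : {poly k} := \sum_(b <- msupp p) (p@_b)%:P * (1 + 'X) ^+ b i.
have q1 : q`_1 != 0.
  have -> : q`_1 = \sum_(b <- msupp p) p@_b * (b i)%:R.
    rewrite coef_sum; apply: eq_bigr => b _; rewrite coefCM; congr (_ * _).
    by rewrite coef1_exp_1DX.
  have -> : \sum_(b <- msupp p) p@_b * (b i)%:R
            = value_at_ones p * e%:R - p@_a.
    rewrite mulr_suml.
    have -> : p@_a = \sum_(b <- msupp p) p@_b * (b == a)%:R.
      rewrite (bigD1_seq a) ?msupp_uniq //= eqxx mulr1 big1 ?addr0 //.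
      by move=> b /negbTE ->; rewrite mulr0.
    rewrite -sumrB big_seq [RHS]big_seq; apply: eq_bigr => b bp.
    by rewrite -mulrBr -(supp_e b bp) natrD addrK.
  by rewrite p1 mul0r sub0r oppr_eq0 -mcoeff_msupp.
split.
  rewrite leNgt; apply/negP => c1.
  pose s (b : 'I_m.+2) : k := (b == ord_max)%:R.
  pose w j : k := (j == i)%:R.
  have /eqP := pI _ idfun s w 1%N c1.
  have -> : line_mpoly idfun p (span_pt I s) w = q.
    rewrite /q -(mmap_single (@polyC k)); apply: eq_mmap => // j.
    rewrite span_ptE Imax /s eqxx coord_pt_neq_max if_same addr0 /w.
    by case: (j == i); rewrite ?mul1r // mul0r addr0.
  by rewrite (negbTE q1).
move=> Ii; rewrite leNgt; apply/negP => c0.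
(* Now L_I contains the whole line through (1, ..., 1) and e_i; evaluating at its generic point
   would give [q] = 0. *)
pose f : {rmorphism k -> {fraction {poly k}}} := @tofrac {poly k} \o @polyC k.
pose s (b : 'I_m.+2) : {fraction {poly k}} :=
  if b == ord_max then 1 else if b == coord_pt i then tofrac 'X else 0.
have /eqP := vanishes_eval f s pI c0.
have -> : mmap f (span_pt I s) p = tofrac q.
  rewrite /q -(mmap_single (@polyC k)) rmorph_mmap; apply: eq_mmap => // j /=.
  rewrite span_ptE Imax /s eqxx coord_pt_neq_max (inj_eq coord_pt_inj).
  case: (j =P i) => [->|_]; first by rewrite Ii rmorphD rmorph1.
  by rewrite if_same addr0 rmorph1.
rewrite tofrac_eq0 => /eqP q0.
by move: q1; rewrite q0 coef0 eqxx.
Qed.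

End Multiplicity.

Arguments coord_pt {m} i.

(** * Covering the multiplicities by hyperplanes spanned by blown-up points *)

Section Covering.
Variable m : nat.
Implicit Types (I J : {set 'I_m.+2}) (s : seq {set 'I_m.+2}).
Implicit Types (mu : {set 'I_m.+2} -> int) (a g : 'X_{1..m.+1}).

(** A sequence, since hyperplanes may repeat; each is given by its m = n - 3 spanning points. *)
Definition covered (d : nat) mu : Prop :=
  exists s, [/\ size s = d, all (fun J => #|J| == m) s &
    forall I, @validE m.+3 I -> mu I <= (count (fun J => I \subset J) s)%:Z].

Lemma sum_count_mem (P : pred {set 'I_m.+2}) (Q : pred {set 'I_m.+2}) s :
  all Q s -> (\sum_(J | Q J) count_mem J s * P J)%N = count P s.
Proof.
elim: s => [|K s IHs] /=; first by rewrite big1.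
case/andP=> QK /IHs <-; rewrite (bigD1 K) //= [in RHS](bigD1 K) //= eqxx.
rewrite mulnDl mul1n addnA; congr (_ + _)%N; apply: eq_bigr => J /andP[_ /negbTE].
by rewrite eq_sym => ->; rewrite add0n.
Qed.

Lemma covered_boundary (D : kclass m.+3) d :
  D.1 = d%:Z -> covered d D.2 -> boundary_comb D.
Proof.
case: D => e mu /= -> [s [sd ss cov]].
have sH : all (@validH m.+3) s.
  by apply: sub_all ss => J; rewrite /validH subSS subn2.
(* The coefficient of E_I is the surplus of hyperplanes through L_I, nonnegative for valid I. *)
exists (fun I => absz ((count (fun J => I \subset J) s)%:Z - mu I)).
exists (fun J => count_mem J s); split=> /=.
  rewrite big1 => [|I _]; last by rewrite mulr0.
  rewrite add0r -sd -(count_predT s) -(sum_count_mem predT sH) -natz natr_sum.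
  by apply: eq_bigr => J _; rewrite natrM natz.
move=> K vK; rewrite (bigD1 K) //= eqxx big1 => [|I /andP[_ /negbTE]]; last first.
  by rewrite eq_sym => ->; rewrite mulr0.
have -> : \sum_(J | @validH m.+3 J)
      (count_mem J s)%:Z * (if K \subset J then 1 else 0)
    = (count (fun J => K \subset J) s)%:Z.
  rewrite -(sum_count_mem _ sH) -natz natr_sum; apply: eq_bigr => J _.
  by rewrite natrM !natz; case: (K \subset J).
by rewrite addr0 mulrN1 gez0_abs ?subr_ge0 ?cov // opprB subrK.
Qed.

(** The divisor of x^g: the points other than e_i and (1, ..., 1) span x_i = 0. *)
Definition star_hyperplanes g : seq {set 'I_m.+2} :=
  flatten [seq nseq (g i) (~: [set coord_pt i; ord_max]) | i <- index_enum 'I_m.+1].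

Lemma count_star (P : pred {set 'I_m.+2}) g :
  count P (star_hyperplanes g)
  = (\sum_i P (~: [set coord_pt i; ord_max]) * g i)%N.
Proof.
rewrite count_flatten sumnE !big_map.
by apply: eq_bigr => i _; rewrite count_nseq.
Qed.

Lemma size_star g : size (star_hyperplanes g) = mdeg g.
Proof.
rewrite -count_predT count_star mdegE.
by apply: eq_bigr => i _; rewrite mul1n.
Qed.

Lemma card_setC2 (u v : 'I_m.+2) : u != v -> #|~: [set u; v]| = m.
Proof. by move=> uv; rewrite cardsCs setCK cards2 card_ord uv subn2. Qed.

Lemma star_card g : all (fun J => #|J| == m) (star_hyperplanes g).
Proof.
apply/allP => J /flattenP[_ /mapP[i _ ->]] /nseqP[-> _].
by rewrite card_setC2 // coord_pt_neq_max.
Qed.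

Lemma subset_setC2 I u v : (I \subset ~: [set u; v]) = (u \notin I) && (v \notin I).
Proof. by rewrite subsetC subUset !sub1set !inE. Qed.

Lemma count_star_sub g I :
  count (fun J => I \subset J) (star_hyperplanes g)
  = if ord_max \in I then 0%N else (\sum_(i in ~: (coord_pt @^-1: I)) g i)%N.
Proof.
rewrite count_star [X in if _ then _ else X]big_mkcond.
case: ifP => mI; last apply: eq_bigr => i _; last first.
  by rewrite subset_setC2 mI andbT !inE; case: (coord_pt i \in I); rewrite ?mul1n.
by rewrite big1 // => i _; rewrite subset_setC2 mI andbF.
Qed.

Lemma imset_coord_preim I : coord_pt @: (coord_pt @^-1: I) \subset I.
Proof. by apply/subsetP => _ /imsetP[i + ->]; rewrite inE. Qed.

(** * Coverings read off from the monomials of a form *)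

Section Forms.
Variables (k : fieldType) (p : {mpoly k[m.+1]}) (d : nat) (mu : {set 'I_m.+2} -> int).
Hypothesis p_neq0 : p != 0.
Hypothesis p_homog : p \is d.-homog.
Hypothesis p_mult : forall I, @validE m.+3 I -> vanishes p I (mu I).

Lemma mdeg_supp a : a \in msupp p -> mdeg a = d.
Proof. exact: (dhomogP _ _ _ p_homog). Qed.

Lemma covered_off_max : value_at_ones p != 0 -> covered d mu.
Proof.
move=> p1; have ap := mlead_supp p_neq0.
exists (star_hyperplanes (mlead p)); split; first by rewrite size_star mdeg_supp.
  exact: star_card.
move=> I vI; rewrite count_star_sub; case: ifP => mI.
  exact: (vanishes_max_le0 (p_mult vI)).
exact: (vanishes_le (p_mult vI) (imset_coord_preim I)).
Qed.

(** The points other than e_i and e_j span x_i = x_j. On a coordinate subspace the two monomials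
    give two bounds, and the smaller one exceeds the count for x^g by 1 only if neither e_i nor e_j
    is in [I], which is when x_i = x_j is counted. If [ord_max] is in [I], x_i = x_j is the only
    hyperplane that can count. *)
Lemma covered_two_monomials g i j :
  i != j -> (g + U_(i))%MM \in msupp p -> (g + U_(j))%MM \in msupp p ->
  (forall I, @validE m.+3 I -> ord_max \in I ->
     [/\ mu I <= 1, coord_pt i \in I -> mu I <= 0 & coord_pt j \in I -> mu I <= 0]) ->
  covered d mu.
Proof.
move=> ij gi gj mu_max.
exists (~: [set coord_pt i; coord_pt j] :: star_hyperplanes g); split=> /=.
- by rewrite size_star -(mdeg_supp gi) mdegD mdeg1 addn1.
- by rewrite star_card card_setC2 ?eqxx // (inj_eq (@coord_pt_inj m)).
move=> I vI; rewrite count_star_sub subset_setC2; case: ifP => mI.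
  have [mu1 mui muj] := mu_max I vI mI.
  by case: (boolP (coord_pt i \in I)) mui; case: (boolP (coord_pt j \in I)) muj;
    lia.
have le_g t : (g + U_(t))%MM \in msupp p ->
    mu I <= ((coord_pt t \notin I) + \sum_(l in ~: (coord_pt @^-1: I)) g l)%N%:Z.
  move=> gt; have := vanishes_le (p_mult vI) (imset_coord_preim I) gt.
  suff -> : (\sum_(l in ~: (coord_pt @^-1: I)) (g + U_(t))%MM l
    = (coord_pt t \notin I) + \sum_(l in ~: (coord_pt @^-1: I)) g l)%N by [].
  under eq_bigr do rewrite mnmDE mnm1E.
  rewrite big_split /= addnC; congr (_ + _)%N.
  rewrite big_mkcond (bigD1 t) //= eqxx !inE big1 => [|l /negbTE].
    by case: (coord_pt t \in I).
  by rewrite eq_sym => ->; rewrite if_same.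
by have := le_g i gi; have := le_g j gj; do 2 case: (_ \in I).
Qed.

Lemma two_monomials : value_at_ones p = 0 ->
  exists a b, [/\ a \in msupp p, b \in msupp p & a != b].
Proof.
move=> p1; have ap := mlead_supp p_neq0; set a := mlead p in ap.
have [/hasP[b bp ba]|/hasPn no] := boolP (has (predC1 a) (msupp p)).
  by exists a, b; split; rewrite // eq_sym.
move: p1; rewrite /value_at_ones (bigD1_seq a) ?msupp_uniq //= big_seq_cond.
rewrite big1 => [|b /andP[/no]]; last by move=> /= /negbNE ->.
by rewrite addr0 => /eqP; rewrite mcoeff_eq0 ap.
Qed.

Lemma covered_deg_le1 : (d <= 1)%N -> covered d mu.
Proof.
move=> d1; have [p1|/covered_off_max//] := eqVneq (value_at_ones p) 0.
have [a [b [ap bp ab]]] := two_monomials p1.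
have [/eqP da /eqP db] := (mdeg_supp ap, mdeg_supp bp).
have [dE|dE] : d = 0%N \/ d = 1%N by lia.
  move: da db ab; rewrite dE !mdeg_eq0 => /eqP-> /eqP->.
  by rewrite eqxx.
rewrite dE in da db.
have [/mdeg1P[i /eqP ai] /mdeg1P[j /eqP bj]] := (da, db).
(* Apply [vanishes_le] to the monomial x_t, with [A] empty and then with [A] = {t}. *)
have mu_le t I : @validE m.+3 I -> U_(t)%MM \in msupp p ->
    mu I <= 1 /\ (coord_pt t \in I -> mu I <= 0).
  move=> vI tp; split.
    have := vanishes_le (A := set0) (p_mult vI) _ tp.
    rewrite imset0 sub0set => /(_ isT).
    suff -> : (\sum_(l in ~: set0) U_(t)%MM l = 1 :> nat)%N by [].
    by rewrite -(mdeg1 t) mdegE; apply: eq_bigl => l; rewrite !inE.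
  move=> tI; have := vanishes_le (A := [set t]) (p_mult vI) _ tp.
  rewrite imset_set1 sub1set tI => /(_ isT).
  rewrite big1 // => l; rewrite !inE mnm1E.
  by rewrite eq_sym => /negbTE ->.
subst a b; apply: (@covered_two_monomials 0%MM i j).
- by apply: contraNneq ab => ->.
- by rewrite add0m.
- by rewrite add0m.
by move=> I vI _; have [? ?] := mu_le i I vI ap; have [_ ?] := mu_le j I vI bp.
Qed.

(** With N_i = d - m_{e_i}, the degree in the hypothesis is sum_i N_i - d. No exponent at [i]
    exceeds N_i, so every monomial of [p] is x^N or x^N / x_i for some i; having the same degree,
    two distinct ones are both of the second kind. *)
Lemma covered_cremona_deg_le1 : (1 < m)%N ->
  (m * d)%N%:Z - \sum_i mu [set coord_pt i] <= 1 -> covered d mu.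
Proof.
move=> m1 deg1; have [p1|/covered_off_max//] := eqVneq (value_at_ones p) 0.
have [a [b [ap bp ab]]] := two_monomials p1.
pose N i : int := d%:Z - mu [set coord_pt i].
have le_N c i : c \in msupp p -> (c i)%:Z <= N i.
  move=> cp; have vi : @validE m.+3 [set coord_pt i].
    by rewrite /validE cards1; lia.
  have := vanishes_le (A := [set i]) (p_mult vi) _ cp.
  rewrite imset_set1 subxx => /(_ isT).
  have : (c i + \sum_(l in ~: [set i]) c l)%N = d.
    rewrite -(mdeg_supp cp) mdegE [RHS](bigD1 i) //=; congr (_ + _)%N.
    by apply: eq_bigl => l; rewrite !inE.
  rewrite /N; move: (\sum_(l in _) c l)%N => S; lia.
have slack c : c \in msupp p -> \sum_i (N i - (c i)%:Z) <= 1.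
  move=> cp; rewrite sumrB /N sumrB sumr_const card_ord.
  have -> : \sum_i (c i)%:Z = d%:Z.
    by rewrite -(mdeg_supp cp) mdegE -natz natr_sum; apply: eq_bigr => i _; rewrite natz.
  move: deg1; rewrite mulrSr -mulr_natr natz; move: (\sum_i _) => S; lia.
(* The differences N_l - c_l are nonnegative with sum at most 1, so a positive one equals 1 and the
   others vanish. *)
have pred_N c i : c \in msupp p -> (c i)%:Z < N i ->
    forall l, N l = ((c l) + (l == i))%N%:Z.
  move=> cp ci l; have := slack c cp; rewrite (bigD1 i) //=.
  have [->|li] := eqVneq l i.
    have : 0 <= \sum_(j | j != i) (N j - (c j)%:Z).
      by apply: sumr_ge0 => j _; rewrite subr_ge0 le_N.
    by move: (\sum_(j | _) _) => S; lia.
  rewrite (bigD1 l) //=.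
  have : 0 <= \sum_(j | (j != i) && (j != l)) (N j - (c j)%:Z).
    by apply: sumr_ge0 => j _; rewrite subr_ge0 le_N.
  by have := le_N c l cp; move: (\sum_(j | _) _) => S; lia.
have exceeds c e : c \in msupp p -> e \in msupp p -> c != e ->
    exists i, (c i < e i)%N.
  move=> cp ep ce; apply/existsP; apply: contraNT ce => /existsPn ge.
  have ec : (e <= c)%MM by apply/mnm_lepP => i; rewrite leqNgt ge.
  have := mdegD (c - e)%MM e; rewrite submK // (mdeg_supp cp) (mdeg_supp ep).
  move=> /esym/eqP; rewrite -{2}(add0n d) eqn_add2r mdeg_eq0 => /eqP c0.
  by rewrite -(submK ec) c0 add0m.
have [i abi] := exceeds a b ap bp ab.
have [j baj] := exceeds b a bp ap (ltac:(by rewrite eq_sym)).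
have aN := pred_N a i ap (ltac:(have := le_N b i bp; lia)).
have bN := pred_N b j bp (ltac:(have := le_N a j ap; lia)).
have abE l : (a l + (l == i) = b l + (l == j))%N by have := aN l; rewrite bN; lia.
(* Only [c] falls short of N at [l]: this is the support condition of [vanishes_max_deriv], with e =
   N_l. *)
have supp_e c l : c \in msupp p -> (forall t, N t = ((c t) + (t == l))%N%:Z) ->
    forall e, e \in msupp p -> (e l + (e == c))%N = absz (N l).
  move=> cp cN e ep; have [->|ec] := eqVneq e c; first by rewrite cN eqxx.
  have [lt_el|] := boolP ((e l)%:Z < N l); last by have := le_N e l ep; lia.
  case/eqP: ec; apply/mnmP => t.
  by have := pred_N e l ep lt_el t; rewrite cN; lia.
(* Since a = N - U_(i) and b = N - U_(j), the common part is N - U_(i) - U_(j). *)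
apply: (@covered_two_monomials (a - U_(j))%MM j i).
- by apply/eqP => ji; move: abi baj; rewrite ji; lia.
- rewrite submK //; apply/mnm_lepP => l; rewrite mnm1E.
  by case: eqP => // <-; lia.
- suff -> : (a - U_(j) + U_(i))%MM = b by [].
  apply/mnmP => l; rewrite mnmDE mnmBE !mnm1E !(eq_sym _ l).
  have := abE l; case: (l =P j) => [->|]; lia.
move=> I vI mI.
have [mu1 mui] := vanishes_max_deriv (p_mult vI) mI p1 ap (supp_e a i ap aN).
by have [_ muj] := vanishes_max_deriv (p_mult vI) mI p1 bp (supp_e b j bp bN).
Qed.

End Forms.
End Covering.

(** * Exchanging a coordinate point with (1, ..., 1) *)

Section SwapPoints.
Variables (k : fieldType) (m : nat) (o : 'I_m.+1).
Implicit Types (p : {mpoly k[m.+1]}) (I : {set 'I_m.+2}).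

Local Notation tau := (tperm (coord_pt o) ord_max).

(* In coordinates: the linear involution exchanging the [o]-th coordinate point
   with (1, ..., 1) and fixing the other coordinate points up to sign. *)
Definition swap_vec (V : zmodType) (h : 'I_m.+1 -> V) : 'I_m.+1 -> V :=
  fun i => if i == o then h o else h o - h i.

Definition swap_form p : {mpoly k[m.+1]} :=
  mmap (@mpolyC m.+1 k) (swap_vec (fun i => 'X_i)) p.

Lemma mmap_swap_form (S : comNzRingType) (g : {rmorphism k -> S}) h p :
  mmap g h (swap_form p) = mmap g (swap_vec h) p.
Proof.
rewrite /swap_form rmorph_mmap; apply: eq_mmap => i /=; first exact: mmapC.
rewrite /swap_vec; case: ifP => _; first by rewrite mmapX mmap1U.
by rewrite mmapB !mmapX !mmap1U.
Qed.

Lemma swap_form_neq0 p : p != 0 -> swap_form p != 0.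
Proof.
(* Substituting twice gives back [p]. *)
apply: contra_neq => p0; have := mmap_swap_form (@mpolyC m.+1 k) (swap_vec (fun i => 'X_i)) p.
rewrite p0 mmap0 => ->; rewrite -[LHS]comp_mpoly_id; apply: eq_mmap => // i.
rewrite tnth_mktuple /swap_vec eqxx.
by case: eqP => [->//|_]; rewrite subKr.
Qed.

Lemma swap_form_homog p d : p \is d.-homog -> swap_form p \is d.-homog.
Proof.
move=> /dhomogP hp; rewrite /swap_form /mmap big_seq rpred_sum // => a /hp /= <-.
rewrite mul_mpolyC rpredZ // mdegE /mmap1.
apply: (big_ind2 (fun (q : {mpoly k[m.+1]}) e => q \is e.-homog)).
- exact: dhomog1.
- by move=> q1 e1 q2 e2; apply: dhomogM.
move=> i _; rewrite -[X in X.-homog]mul1n; apply: dhomogMn.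
have hX j : ('X_j : {mpoly k[m.+1]}) \is 1.-homog by rewrite dhomogX /= mdeg1.
by rewrite /swap_vec; case: ifP => _ //; rewrite rpredB.
Qed.

Lemma swap_form_vanishes p I (c : int) :
  vanishes p (tau @^-1: I) c -> vanishes (swap_form p) I c.
Proof.
move=> pI K f s w j jc.
(* The involution sends e_i to - e_i for i <> o, hence the sign. *)
pose s' b := if (b == ord_max) || (b == coord_pt o) then s (tau b) else - s b.
rewrite -[RHS](pI K f s' (swap_vec w) j jc) /line_mpoly mmap_swap_form.
congr (nth _ (polyseq _) _); apply: eq_mmap => // i.
suff -> : span_pt (tau @^-1: I) s' i = swap_vec (span_pt I s) i.
  rewrite /swap_vec; case: ifP => // _.
  by rewrite !rmorphB /= mulrBl opprD addrACA.
rewrite /swap_vec !span_ptE /s' !inE eqxx /= coord_pt_neq_max tpermR.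
rewrite (inj_eq (@coord_pt_inj m)).
have [->|io] := eqVneq i o; first by rewrite tpermL addrC.
rewrite tpermD ?(inj_eq (@coord_pt_inj m)) 1?eq_sym ?coord_pt_neq_max //.
case: (ord_max \in I); case: (coord_pt o \in I); case: (coord_pt i \in I).
all: by rewrite /=; ring.
Qed.

Lemma covered_swap d (mu : {set 'I_m.+2} -> int) :
  covered d (fun I => mu (tau @^-1: I)) -> covered d mu.
Proof.
have tauK I : tau @^-1: (tau @^-1: I) = I by apply/setP => b; rewrite !inE tpermK.
have card_tau I : #|tau @^-1: I| = #|I| by rewrite card_preimset //; apply: perm_inj.
move=> [s [sd ss cov]]; exists [seq tau @^-1: J | J : {set 'I_m.+2} <- s]; split.
- by rewrite size_map.
- by rewrite all_map; apply: sub_all ss => J /=; rewrite card_tau.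
move=> I vI; have := cov (tau @^-1: I); rewrite tauK /validE card_tau => /(_ vI).
rewrite count_map => /le_trans; apply; rewrite lez_nat.
by apply: sub_count => J /= /(preimsetS tau); rewrite tauK.
Qed.

End SwapPoints.

(** * From divisor classes to forms, and conclusion *)

Lemma effective_form (k : fieldType) (m : nat) (D : kclass m.+3) :
  effective k D -> exists (d : nat) (p : {mpoly k[m.+1]}),
    [/\ D.1 = d%:Z, p != 0, p \is d.-homog &
        forall I : {set 'I_m.+2}, @validE m.+3 I -> vanishes p I (D.2 I)].
Proof.
move=> [d [F [Dd [/existsP[a /andP[ma Fa]] multF]]]].
pose mnm (b : mono m.+3 d) := [multinom (b i : nat) | i < m.+1].
have mnm_inj : injective mnm.
  move=> b c /mnmP bc; apply/ffunP => i; apply/val_inj.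
  by have := bc i; rewrite !mnmE.
pose p : {mpoly k[m.+1]} := \sum_(b | is_mono b) F b *: 'X_[mnm b].
exists d, p; split=> //.
- apply: contraNneq Fa => p0; have := congr1 (mcoeff (mnm a)) p0.
  rewrite mcoeff0 raddf_sum /= (bigD1 a) //= big1 => [|b /andP[_ ba]].
    by rewrite mcoeffZ mcoeffX eqxx mulr1 addr0 => ->.
  by rewrite mcoeffZ mcoeffX (inj_eq mnm_inj) (negbTE ba) mulr0.
- apply: rpred_sum => b /eqP mb; rewrite rpredZ // dhomogX /= mdegE -[X in _ == X]mb.
  by apply/eqP/eq_bigr => i _; rewrite mnmE.
move=> I vI K f s w j jc; rewrite -[RHS](multF I vI K f s w j jc); congr (nth _ (polyseq _) _).
rewrite /line_mpoly /p raddf_sum; apply: eq_bigr => b _ /=.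
rewrite mmapZ mmapX /= mul_polyC /mmap1; congr (_ *: _).
by apply: eq_bigr => i _; rewrite mnmE.
Qed.

Lemma deg_min_attained (n : nat) (D : kclass n) :
  deg_min D = D.1 \/ exists j, deg_min D = deg_at D j.
Proof.
rewrite /deg_min; elim/big_ind: _ => [|x y IHx IHy|j _]; first by left.
  by rewrite minEle; case: ifP.
by right; exists j.
Qed.

(** Turns the sum in [deg_at] into a sum over coordinate points, as [covered_cremona_deg_le1]
    requires. *)
Lemma sum_tperm_coord (m : nat) (F : 'I_m.+2 -> int) (a : 'I_m.+2) :
  \sum_i F (tperm a ord_max (coord_pt i)) = \sum_(b | b != a) F b.
Proof.
rewrite [RHS](reindex_inj (@perm_inj _ (tperm a ord_max))) /=.
rewrite [RHS]big_mkcond big_points tpermR eqxx add0r; apply: eq_bigr => i _.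
by rewrite (canF_eq (tpermK _ _)) tpermL coord_pt_neq_max.
Qed.

Theorem mainTheorem16 (k : fieldType) (n : nat) (hn : (5 <= n)%N)
  (D : kclass n) (hD : effective k D)
  (hdeg : deg_min D = 0 \/ deg_min D = 1) :
  boundary_comb D.
Proof.
case: n hn D hD hdeg => [|[|[|m]]] // m1 D /effective_form[d [p [Dd p0 hp pD]]] hdeg.
apply: (covered_boundary Dd).
have deg1 : deg_min D <= 1 by case: hdeg => ->.
(* The case where the minimum is attained at the distinguished point. *)
have d_case : D.1 <= 1 -> covered d D.2.
  by rewrite Dd => d1; apply: covered_deg_le1 p0 hp pD _; lia.
case: (deg_min_attained D) deg1 => [->//|[j ->]].
rewrite /deg_at; case: eqP => // /eqP jm.
have jlt : (j < m.+2)%N by have := ltn_ord j; move: jm => /=; lia.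
pose a : 'I_m.+2 := Ordinal jlt.
rewrite Dd subSS subn2 /= (eq_bigl (fun b : 'I_m.+2 => b != a)) //.
rewrite -(sum_tperm_coord (fun b => D.2 [set b])) => deg1.
have m_gt1 : (1 < m)%N by lia.
(* The minimum is attained at a blown-up point: either (1, ..., 1) itself, or some e_o, which the
   swap moves there. *)
case: (unliftP ord_max a) deg1 => [o ->|->] deg1; last first.
  apply: covered_cremona_deg_le1 p0 hp pD m_gt1 _.
  by move: deg1; rewrite tperm1; under eq_bigr do rewrite perm1.
apply: (@covered_swap m o).
apply: (covered_cremona_deg_le1 (swap_form_neq0 o p0) (swap_form_homog o hp) _ m_gt1).
  move=> I vI; apply: swap_form_vanishes; apply: pD.
  by rewrite /validE card_preimset //; apply: perm_inj.
apply: le_trans deg1; rewrite PoszM lerD2l lerN2 le_eqVlt; apply/orP; left.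
apply/eqP/eq_bigr => i _; congr (D.2 _); apply/setP => b; rewrite !inE.
by rewrite (canF_eq (tpermK _ _)).
Qed.
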